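(* Let $R\subset T$ be a minimal ring extension with crucial maximal ideal $J$, and suppose that $T$ is an integral domain. Then $(R:T)=0$ if and only if either $R$ is a field and $T$ is a minimal field extension of $R$, or $R_J$ is a valuation ring of altitude one and $T_J$ is its quotient field.
   Context: All rings are commutative with nonzero identity, and all ring extensions (subrings) and ring homomorphisms are unital. For a proper subring $R$ of a ring $T$, $R\subset T$ is called a minimal ring extension if there is no ring $S$ with $R\subset S\subset T$, where $\subset$ denotes proper inclusion. A minimal field extension is a field extension that is a minimal ring extension. The conductor is $(R:T)=\{t\in T : tT\subseteq R\}$. For a prime ideal $P$ of $R$, $T_P:=T_{R\setminus P}$ is the localization of $T$ at the multiplicative set $R\setminus P$. If $R\subset T$ is a minimal ring extension, it is known that there is a unique maximal ideal $J$ of $R$ such that the canonical map $R_J\hookrightarrow T_J$ is not an isomorphism; this $J$ is called the crucial maximal ideal of $R\subset T$ (moreover $R_J\hookrightarrow T_J$ is then a minimal ring extension, and $R_P\hookrightarrow T_P$ is an isomorphism for every prime $P\neq J$ of $R$). ''Altitude'' means Krull dimension; a valuation ring is a valuation domain. *)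

(* Defs.v *)
From HB Require Import structures.
From mathcomp Require Import all_boot all_algebra.
From mathcomp Require Import boolp classical_sets.

Set Implicit Arguments.
Unset Strict Implicit.
Unset Printing Implicit Defensive.

Import GRing.Theory.
Local Open Scope ring_scope.
Local Open Scope classical_set_scope.

(* Subrings are unital and are represented by their underlying sets inside an
   ambient ring; [A] and [B] below are meant to be subrings of [U], and ideals
   are ideals of the subring [A], not of [U]. *)
Section Subrings.
Variable U : comNzRingType.
Implicit Types A B S I P M : set U.

Definition is_subring A : Prop := GRing.subring_closed (mem A).

Definition minimal_ring_extension A B : Prop :=
  [/\ is_subring A, is_subring B, A `<` B &
      ~ exists S, [/\ is_subring S, A `<` S & S `<` B]].

Definition conductor A B : set U :=
  [set t | B t /\ forall u, B u -> A (t * u)].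

Definition is_field A : Prop :=
  is_subring A /\ forall x, A x -> x != 0 -> exists2 y, A y & x * y = 1.

Definition minimal_field_extension A B : Prop :=
  [/\ is_field A, is_field B & minimal_ring_extension A B].

Definition is_ideal A I : Prop :=
  [/\ I `<=` A, I 0, (forall x y, I x -> I y -> I (x + y)) &
      forall a x, A a -> I x -> I (a * x)].

Definition prime_ideal A P : Prop :=
  [/\ is_ideal A P, P <> A &
      forall x y, A x -> A y -> P (x * y) -> P x \/ P y].

Definition maximal_ideal A M : Prop :=
  [/\ is_ideal A M, M <> A &
      forall I, is_ideal A I -> M `<=` I -> I = M \/ I = A].

Definition prime_chain A (n : nat) (Q : nat -> set U) : Prop :=
  (forall i, (i <= n)%N -> prime_ideal A (Q i)) /\
  (forall i, (i < n)%N -> Q i `<` Q i.+1).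

(* Chains are indexed by their number [n] of strict inclusions, so this is
   Krull dimension [n]. *)
Definition has_altitude A (n : nat) : Prop :=
  (exists Q, prime_chain A n Q) /\
  (forall m Q, prime_chain A m Q -> (m <= n)%N).

End Subrings.

Section Valuation.
Variable K : fieldType.
Implicit Types A : set K.

Definition quotient_field A : set K :=
  [set x | exists a b, [/\ A a, A b, b != 0 & x = a / b]].

(* Fields count as (trivial) valuation rings. *)
Definition valuation_ring A : Prop :=
  is_subring A /\
  forall x, quotient_field A x -> x != 0 -> A x \/ A x^-1.

End Valuation.

Section Localization.
Variable T : idomainType.
Implicit Types R P A B J : set T.

(* The localization of [A] at the multiplicative set [R \ P]. As [T] is a domain
   (and [0] is in [P]), it is realized as a subring of the fraction field of [T],
   and the canonical map between the localizations of two subrings [A] and [B],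
   with [A `<=` B], is the inclusion of the corresponding sets. *)
Definition localization R P A : set {fraction T} :=
  [set x | exists a s, [/\ A a, R s, ~ P s &
                        x = FracField.tofrac a / FracField.tofrac s]].

(* For a minimal extension there is exactly one such [J]; the canonical map is
   injective, hence it is an isomorphism iff the two sets are equal. *)
Definition crucial_maximal_ideal A B J : Prop :=
  maximal_ideal A J /\ localization A J A <> localization A J B.

End Localization.

(* Main.v *)
Require Import Defs.
From HB Require Import structures.
From mathcomp Require Import all_boot all_algebra.
From mathcomp Require Import boolp classical_sets.
From mathcomp Require Import ring.

(** Suppose first that the conductor is zero. Everything rests on one remark: if
    [A `<` B] is minimal with zero conductor and [x] is a nonzero element of [B],
    then the intermediate ring [A + xB] cannot be [A], so [A + xB = B]
    ([conductor0_divisible]).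

    If [J = 0], then [R] is a field, and the remark applied to [x^2] makes [T] a
    field ([minimal_over_field]).

    If [J] is nonzero, the extension is replaced by its localization at [J], which
    is again minimal with zero conductor. So let [A] be local with nonzero maximal
    ideal [M], and let [A `<` B] be minimal with zero conductor in a field.
    - By the remark, [B = A + mB] for any nonzero [m] in [M]. If some element [b]
      of [B] outside [A] were integral over [A], then [B = A[b]] would be a finite
      [A]-module, and Nakayama's lemma would give [B = A]. Hence [A] is integrally
      closed in [B] ([integrally_closed]).
    - For [t] in [B] outside [A], the remark gives [t = a + t^2 b] with [b] in
      [B = A[t]]. Thus [t] satisfies a polynomial relation over [A] with a unit
      coefficient, and over a local ring that is integrally closed in [B] this
      forces [t^-1] to be in [A] ([unit_coef_inv], [inv_in_sub]).
    - From this [B] is the quotient field of [A], and [A] is a valuation ring.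
      A nonzero prime [P] of [A] contains every nonzero [x] in [M]: by minimality
      [B = A[1/x]], so that some power of [x] is a multiple in [A] of any given
      nonzero element of [P].
      Hence [A] has altitude one.

    Conversely, an extension [A `<` B] whose top ring [B] is a field has zero
    conductor, since a nonzero conductor element generates [B]. This settles the
    case of fields, and applied to the localizations it settles the other case,
    because the conductor of [R] in [T] embeds in that of the localizations. *)

Set Implicit Arguments.
Unset Strict Implicit.
Unset Printing Implicit Defensive.

Import GRing.Theory.
Local Open Scope ring_scope.
Local Open Scope classical_set_scope.

(** * Subrings and minimal extensions *)

Section Subring.
Variable U : comNzRingType.
Implicit Types A B S I : set U.

Lemma is_subringP A : is_subring A <->
  [/\ A 1, (forall x y, A x -> A y -> A (x - y)) &
      (forall x y, A x -> A y -> A (x * y))].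
Proof.
split=> [] [A1 AB AM]; split.
- by move: A1; rewrite inE.
- by move=> x y Ax Ay; have := AB x y; rewrite !inE; apply.
- by move=> x y Ax Ay; have := AM x y; rewrite !inE; apply.
- by rewrite inE.
- by move=> x y; rewrite !inE; apply: AB.
- by move=> x y; rewrite !inE; apply: AM.
Qed.

Section Closure.
Variables (A : set U) (subA : is_subring A).

Lemma subring1 : A 1.
Proof. by case/is_subringP: subA. Qed.

Lemma subringB x y : A x -> A y -> A (x - y).
Proof. by case/is_subringP: subA => _ + _; apply. Qed.

Lemma subringM x y : A x -> A y -> A (x * y).
Proof. by case/is_subringP: subA => _ _; apply. Qed.

Lemma subring0 : A 0.
Proof. by rewrite -(subrr 1); apply: subringB; apply: subring1. Qed.

Lemma subringN x : A x -> A (- x).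
Proof. by rewrite -sub0r; apply: subringB; apply: subring0. Qed.

Lemma subringD x y : A x -> A y -> A (x + y).
Proof. by move=> Ax Ay; rewrite -[y]opprK; apply/subringB/subringN. Qed.

Lemma subringX x n : A x -> A (x ^+ n).
Proof.
move=> Ax; elim: n => [|n IHn]; first by rewrite expr0; apply: subring1.
by rewrite exprS; apply: subringM.
Qed.

End Closure.

Section Ideal.
Variables (A I : set U) (subA : is_subring A) (idI : is_ideal A I).

Lemma ideal_sub x : I x -> A x.
Proof. by case: idI => + _ _ _; apply. Qed.

Lemma ideal0 : I 0.
Proof. by case: idI. Qed.

Lemma idealD x y : I x -> I y -> I (x + y).
Proof. by case: idI => _ _ + _; apply. Qed.

Lemma idealM a x : A a -> I x -> I (a * x).
Proof. by case: idI => _ _ _; apply. Qed.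

Lemma idealB x y : I x -> I y -> I (x - y).
Proof.
move=> Ix Iy; apply: idealD => //; rewrite -mulN1r; apply: idealM => //.
by apply: subringN => //; apply: subring1.
Qed.

Lemma ideal_eq_ring : I 1 -> I = A.
Proof.
move=> I1; apply/seteqP; split=> x; first exact: ideal_sub.
by move=> Ax; rewrite -[x]mulr1; apply: idealM.
Qed.

End Ideal.

(** The complement of a maximal ideal is multiplicative, because [A x + J = A]
    for [x] outside [J]. *)
Lemma maximal_ideal_mul A J x y : is_subring A -> maximal_ideal A J ->
  A x -> A y -> ~ J x -> ~ J y -> ~ J (x * y).
Proof.
move=> subA [idJ _ maxJ] Ax Ay nJx nJy Jxy.
pose I := [set z | exists r j, [/\ A r, J j & z = r * x + j]].
have JI : J `<=` I.
  move=> j Jj; exists 0, j; split=> //; first exact: subring0.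
  by rewrite mul0r add0r.
have Ix : I x.
  exists 1, 0; split; [exact: subring1|exact: (ideal0 idJ)|].
  by rewrite mul1r addr0.
have idI : is_ideal A I.
  split.
  - move=> _ [r [j [Ar Jj ->]]]; apply: subringD => //.
      exact: subringM.
    exact: ideal_sub Jj.
  - by apply: JI; exact: ideal0 idJ.
  - move=> _ _ [r [j [Ar Jj ->]]] [r' [j' [Ar' Jj' ->]]].
    exists (r + r'), (j + j'); split.
    + exact: subringD.
    + exact: (idealD idJ).
    + by ring.
  - move=> a _ Aa [r [j [Ar Jj ->]]].
    exists (a * r), (a * j); split.
    + exact: subringM.
    + exact: (idealM idJ).
    + by ring.
case: (maxJ I idI JI) => [IJ|IA].
  by apply: nJx; rewrite -IJ.
have [r [j [Ar Jj e1]]] : I 1 by rewrite IA; apply: subring1.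
apply: nJy.
have -> : y = r * (x * y) + y * j.
  by rewrite -[LHS]mulr1 e1; ring.
by apply: (idealD idJ); apply: (idealM idJ).
Qed.

Section Minimal.
Variables (A B : set U) (minAB : minimal_ring_extension A B).

Lemma minimal_sub : A `<=` B.
Proof. by case: minAB => _ _ []. Qed.

Lemma minimal_intermediate S :
  is_subring S -> A `<=` S -> S `<=` B -> S = A \/ S = B.
Proof.
move=> subS AS SB; case: minAB => _ _ _ noS.
case: (pselect (S `<=` A)) => [SA|nSA].
  by left; apply/seteqP.
case: (pselect (B `<=` S)) => [BS|nBS].
  by right; apply/seteqP.
by case: noS; exists S.
Qed.

Lemma minimal_intermediate_all S x : is_subring S -> A `<=` S -> S `<=` B ->
  S x -> ~ A x -> B `<=` S.
Proof.
move=> subS AS SB Sx nAx; case: (minimal_intermediate subS AS SB) => [SA|-> //].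
by case: nAx; rewrite -SA.
Qed.

Lemma minimal_ex : exists2 u, B u & ~ A u.
Proof.
case: minAB => _ _ [_ nBA] _; apply: contra_notP nBA => h x Bx.
by apply: contra_notP h => nAx; exists x.
Qed.

(** Since [A + xB] is a ring between [A] and [B], it is [A] or [B], and it is
    [A] only when [x] is in the conductor. *)
Lemma conductor0_divisible x : conductor A B = [set 0] -> B x -> x != 0 ->
  forall y, B y -> exists a b, [/\ A a, B b & y = a + x * b].
Proof.
move=> cond0 Bx x_neq0.
case: minAB => subA subB _ _.
have AB := minimal_sub.
pose S := [set y | exists a b, [/\ A a, B b & y = a + x * b]].
have subS : is_subring S.
  apply/is_subringP; split.
  - exists 1, 0; split; [exact: subring1|exact: subring0|by rewrite mulr0 addr0].
  - move=> _ _ [a [b [Aa Bb ->]]] [a' [b' [Aa' Bb' ->]]].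
    exists (a - a'), (b - b'); split; [exact: subringB|exact: subringB|ring].
  - move=> _ _ [a [b [Aa Bb ->]]] [a' [b' [Aa' Bb' ->]]].
    exists (a * a'), (a * b' + a' * b + x * (b * b')); split.
    + exact: subringM.
    + apply: subringD => //; last by do 2!apply: subringM => //.
      by apply: subringD => //; apply: subringM => //; apply: AB.
    + by ring.
have AS : A `<=` S.
  move=> a Aa; exists a, 0; split=> //; first exact: subring0.
  by rewrite mulr0 addr0.
have SB : S `<=` B.
  move=> _ [a [b [Aa Bb ->]]]; apply: subringD => //; first exact: AB.
  exact: subringM.
case: (minimal_intermediate subS AS SB) => [SA|eSB]; last first.
  by move=> y By; suff: S y by []; rewrite eSB.
have : conductor A B x.
  split=> // u Bu; rewrite -SA; exists 0, u; split=> //; first exact: subring0.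
  by rewrite add0r.
by rewrite cond0 /= => x0; rewrite x0 eqxx in x_neq0.
Qed.

End Minimal.

(** * Polynomial expressions in one element *)

Definition power_span A (b : U) (n : nat) : set U :=
  [set x | exists2 c : nat -> U, forall i, A (c i) &
                                 x = \sum_(i < n) c i * b ^+ i].

Section PowerSpan.
Variables (A : set U) (subA : is_subring A) (b : U).
Local Notation span := (power_span A b).

Lemma power_span0 n : span n 0.
Proof.
exists (fun=> 0) => [_|]; first exact: subring0.
by rewrite big1 // => i _; rewrite mul0r.
Qed.

Lemma power_spanD n x y : span n x -> span n y -> span n (x + y).
Proof.
move=> [c Ac ->] [d Ad ->]; exists (fun i => c i + d i) => [i|].
  exact: subringD.
by rewrite -big_split /=; apply: eq_bigr => i _; rewrite mulrDl.
Qed.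

Lemma power_spanZ n a x : A a -> span n x -> span n (a * x).
Proof.
move=> Aa [c Ac ->]; exists (fun i => a * c i) => [i|]; first exact: subringM.
by rewrite mulr_sumr; apply: eq_bigr => i _; rewrite mulrA.
Qed.

Lemma power_span_sum n m (F : 'I_m -> U) :
  (forall i, span n (F i)) -> span n (\sum_(i < m) F i).
Proof.
move=> spanF; elim/big_ind: _ => //; first exact: power_span0.
exact: power_spanD.
Qed.

Lemma power_span_exp n k : (k < n)%N -> span n (b ^+ k).
Proof.
move=> kn; exists (fun i => (i == k)%:R) => [i|].
  by case: eqP => _; [apply: subring1|apply: subring0].
rewrite (bigD1 (Ordinal kn)) //= eqxx mul1r big1 ?addr0 // => i /eqP ik.
by case: eqP => [e|]; [case: ik; apply: val_inj|rewrite mul0r].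
Qed.

Lemma power_span_linear n m x (f : U -> U) :
  (forall y z, f (y + z) = f y + f z) -> f 0 = 0 ->
  (forall a y, f (a * y) = a * f y) ->
  (forall k, (k < n)%N -> span m (f (b ^+ k))) -> span n x -> span m (f x).
Proof.
move=> fD f0 fZ fm [c Ac ->]; rewrite (big_morph f fD f0).
by apply: power_span_sum => i; rewrite fZ; apply: power_spanZ; last exact: fm.
Qed.

Lemma power_span_mull n m x y :
  (forall k, (k < n)%N -> span m (y * b ^+ k)) -> span n x -> span m (y * x).
Proof.
apply: power_span_linear => [u v||a u]; [exact: mulrDr|exact: mulr0|exact: mulrCA].
Qed.

Lemma power_span_id n m x :
  (forall k, (k < n)%N -> span m (b ^+ k)) -> span n x -> span m x.
Proof. by move=> h; apply: (@power_span_linear n m x id). Qed.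

Lemma power_span_widen n m x : (n <= m)%N -> span n x -> span m x.
Proof.
move=> nm; apply: power_span_id => k kn; apply: power_span_exp.
exact: leq_trans nm.
Qed.

Lemma power_spanM n m x y : span n x -> span m y -> span (n + m) (x * y).
Proof.
move=> nx my; apply: power_span_mull my => k km; rewrite mulrC.
apply: power_span_mull nx => i i_n; rewrite -exprD; apply: power_span_exp.
by rewrite addnC -addSn leq_add // ltnW.
Qed.

Lemma power_span1 x : span 1 x <-> A x.
Proof.
split=> [[c Ac ->]|Ax]; first by rewrite big_ord1 expr0 mulr1.
by exists (fun=> x) => //; rewrite big_ord1 expr0 mulr1.
Qed.

Lemma power_span_sub B n : is_subring B -> A `<=` B -> B b -> span n `<=` B.
Proof.
move=> subB AB Bb _ [c Ac ->]; elim/big_ind: _ => [||i _].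
- exact: subring0.
- exact: subringD.
- by apply: subringM => //; [apply: AB|apply: subringX].
Qed.

(** A monic relation for [b] rewrites every power of [b] in terms of the powers
    of exponent less than [n]. *)
Lemma monic_power_span n m x : (0 < n)%N -> span n (b ^+ n) ->
  span m x -> span n x.
Proof.
move=> n_gt0 monic_b; apply: power_span_id => k _.
elim: k => [|k IHk]; first exact: power_span_exp.
rewrite exprS; apply: power_span_mull IHk => i i_n; rewrite -exprS.
case: (ltngtP i.+1 n) i_n => // [i1n _|-> //].
exact: power_span_exp.
Qed.

(** The polynomial expressions in [b] form a ring between [A] and [B] that
    contains [b], so by minimality it is [B]. *)
Lemma minimal_adjoin B : minimal_ring_extension A B -> B b -> ~ A b ->
  forall x, B x -> exists n, span n x.
Proof.
move=> minAB Bb nAb; have [_ subB _ _] := minAB.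
pose S := [set x | exists n, span n x].
have subS : is_subring S.
  apply/is_subringP; split.
  - by exists 1%N; apply/power_span1; apply: subring1.
  - move=> x y [n nx] [m my]; exists (n + m)%N; apply: power_spanD.
      exact: power_span_widen (leq_addr _ _) nx.
    rewrite -mulN1r; apply: power_spanZ.
      by apply: subringN => //; apply: subring1.
    exact: power_span_widen (leq_addl _ _) my.
  - by move=> x y [n nx] [m my]; exists (n + m)%N; apply: power_spanM.
apply: (minimal_intermediate_all minAB subS _ _ _ nAb).
- by move=> x Ax; exists 1%N; apply/power_span1.
- by move=> x [n]; apply: power_span_sub => //; apply: minimal_sub.
- by exists 2%N; rewrite -[b]expr1; apply: (@power_span_exp 2 1).
Qed.

End PowerSpan.

End Subring.

(** A domain that is minimal over a field, with zero conductor, is a field: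
    write [x = r + x^2 g] with [r] in the base field. Then [x (1 - x g) = r]
    is invertible unless [r = 0], and in that case [x g = 1]. *)
Lemma minimal_over_field (T : idomainType) (A B : set T) :
  minimal_ring_extension A B -> conductor A B = [set 0] -> is_field A ->
  is_field B.
Proof.
move=> minAB cond0 [subA invA]; have [_ subB _ _] := minAB.
split=> // x Bx x_neq0; have x2_neq0 : x ^+ 2 != 0 by rewrite expf_neq0.
have [r [g [Ar Bg ex]]] :=
  conductor0_divisible minAB cond0 (subringX subB 2 Bx) x2_neq0 Bx.
have B1xg : B (1 - x * g).
  by apply: subringB => //; [apply: subring1|apply: subringM].
have exr : x * (1 - x * g) = r by rewrite mulrBr mulr1 {1}ex; ring.
have [r0|r_neq0] := eqVneq r 0; last first.
  have [s As rs1] := invA r Ar r_neq0; exists ((1 - x * g) * s).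
    by apply: subringM => //; apply: (minimal_sub minAB).
  by rewrite mulrA exr.
exists g => //; move/eqP: exr; rewrite r0 mulf_eq0 (negPf x_neq0) /=.
by rewrite subr_eq0 => /eqP.
Qed.

(** * Minimal extensions of a local domain with zero conductor *)

Section Local.
Variables (K : fieldType) (A B M : set K).
Hypothesis minAB : minimal_ring_extension A B.
Hypothesis cond0 : conductor A B = [set 0].
Hypothesis idM : is_ideal A M.
Hypothesis M1 : ~ M 1.
Hypothesis invA : forall x, A x -> ~ M x -> A x^-1.
Variable m : K.
Hypotheses (Mm : M m) (m_neq0 : m != 0).

Let subA : is_subring A. Proof. by case: minAB. Qed.
Let subB : is_subring B. Proof. by case: minAB. Qed.
Let AB : A `<=` B. Proof. exact: minimal_sub minAB. Qed.
Let Am : A m. Proof. exact: ideal_sub idM _ Mm. Qed.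

Lemma one_sub_unit x : A x -> M x -> 1 - x != 0 /\ A (1 - x)^-1.
Proof.
move=> Ax Mx; have nM : ~ M (1 - x).
  by move=> M1x; apply: M1; rewrite -[1](subrK x); apply: (idealD idM).
split; last by apply: invA => //; apply: subringB => //; apply: subring1.
by apply: contra_notN nM => /eqP ->; apply: (ideal0 idM).
Qed.

(** Nakayama's lemma, applied to the divisible module [B / A] through the
    equality [B = A + mB]. *)
Lemma not_finitely_spanned b n : B b -> ~ B `<=` power_span A b n.+1.
Proof.
move=> Bb; elim: n => [|n IHn] fin.
  have [u Bu nAu] := minimal_ex minAB.
  by apply: nAu; apply/(power_span1 A b)/fin.
apply: IHn => x /fin; apply: power_span_id => // k.
rewrite ltnS leq_eqVlt => /predU1P[->|]; last exact: power_span_exp.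
have [a [y [Aa By ey]]] :=
  conductor0_divisible minAB cond0 (AB Am) m_neq0 (subringX subB n.+1 Bb).
have [c Ac ec] := fin y By.
rewrite big_ord_recr /= in ec.
set z := \sum_(i < n.+1) _ in ec.
have [u_neq0 Au] : 1 - m * c n.+1 != 0 /\ A (1 - m * c n.+1)^-1.
  by apply: one_sub_unit; [apply: subringM|rewrite mulrC; apply: (idealM idM)].
have -> : b ^+ n.+1 = (1 - m * c n.+1)^-1 * (a + m * z).
  apply: (mulfI u_neq0); rewrite mulrA divff // mul1r.
  by rewrite mulrBl mul1r {1}ey ec; ring.
apply: power_spanZ => //; apply: power_spanD => //.
  apply: power_span_widen (_ : (1 <= n.+1)%N) _ => //.
  exact/power_span1.
by apply: power_spanZ => //; exists c.
Qed.

Lemma integrally_closed b n : B b -> (0 < n)%N -> power_span A b n (b ^+ n) ->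
  A b.
Proof.
case: n => // n Bb _ monic_b; apply: contrapT => nAb.
apply: (@not_finitely_spanned b n Bb) => x Bx.
have [k kx] := minimal_adjoin subA minAB Bb nAb Bx.
exact: monic_power_span kx.
Qed.

(** Multiplying the relation [c_(n+1) t^(n+1) + ... + c_0 = 0] by [c_(n+1)^n]
    gives a monic relation for [c_(n+1) t]. *)
Lemma lead_coef_integral (c : nat -> K) n t : (forall i, A (c i)) -> B t ->
  \sum_(i < n.+2) c i * t ^+ i = 0 -> A (c n.+1 * t).
Proof.
move=> Ac Bt; rewrite big_ord_recr /= => eq0.
apply: (@integrally_closed _ n.+1) => //.
  by apply: subringM => //; apply: AB.
exists (fun i => - (c i * c n.+1 ^+ (n - i))) => [i|].
  by apply: subringN => //; apply: subringM => //; apply: subringX.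
have -> : (c n.+1 * t) ^+ n.+1 = c n.+1 ^+ n * (c n.+1 * t ^+ n.+1).
  by rewrite exprMn mulrA -exprSr.
have -> : c n.+1 * t ^+ n.+1 = - \sum_(i < n.+1) c i * t ^+ i.
  by apply/eqP; rewrite -addr_eq0 addrC eq0.
rewrite mulrN mulr_sumr -sumrN; apply: eq_bigr => i _.
have -> : c n.+1 ^+ n = c n.+1 ^+ (n - i) * c n.+1 ^+ i.
  by rewrite -exprD subnK // -ltnS.
by rewrite exprMn; ring.
Qed.

(** The descent is on the degree of the relation: the coefficients of [t^(n+1)]
    and [t^n] are merged into the single coefficient [c_(n+1) t + c_n] of [t^n],
    which lies in [A] by integral closedness. If [c_(n+1) t] is a unit of [A],
    then [t] has its inverse in [A]. Otherwise [c_(n+1)] is not a unit, since [t] is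
    outside [A], and adding the non-unit [c_(n+1) t] to [c_n] keeps a unit
    coefficient in the new relation. *)
Lemma unit_coef_inv (c : nat -> K) n j t : (forall i, A (c i)) -> B t -> ~ A t ->
  (j <= n)%N -> ~ M (c j) -> \sum_(i < n.+1) c i * t ^+ i = 0 -> A t^-1.
Proof.
move=> + Bt nAt; elim: n c j => [|n IHn] c j Ac.
  rewrite leqn0 => /eqP-> nM0; rewrite big_ord1 expr0 mulr1 => c0.
  by case: nM0; rewrite c0; apply: (ideal0 idM).
move=> jn nMj eq0; have Act := lead_coef_integral Ac Bt eq0.
have unit_inv a : A a -> ~ M (a * t) -> A (a * t) -> A t^-1.
  move=> Aa nMat Aat; have at_neq0 : a * t != 0.
    by apply: contra_notN nMat => /eqP ->; apply: (ideal0 idM).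
  have -> : t^-1 = a * (a * t)^-1.
    by move: at_neq0; rewrite mulf_eq0 negb_or => /andP[a0 t0]; field; apply/andP.
  by apply: subringM => //; apply: invA.
case: (pselect (M (c n.+1 * t))) => [Mct|nMct]; last exact: unit_inv nMct Act.
have jn' : (j <= n)%N.
  rewrite -ltnS ltn_neqAle jn andbT; apply: contra_notN nAt => /eqP ej.
  rewrite ej in nMj; have c_neq0 : c n.+1 != 0.
    by apply: contra_notN nMj => /eqP ->; apply: (ideal0 idM).
  by rewrite -(mulKf c_neq0 t); apply: subringM => //; apply: invA.
pose d i := if i == n then c n + c n.+1 * t else c i.
apply: (IHn d j) => //.
- by move=> i; rewrite /d; case: eqP => // _; apply: subringD.
- rewrite /d; case: eqP => // ej Md; apply: nMj; rewrite ej.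
  by rewrite -[c n](addrK (c n.+1 * t)); apply: (idealB subA idM).
- rewrite -[RHS]eq0 [RHS]big_ord_recr [X in _ = X + _]big_ord_recr /=.
  rewrite [LHS]big_ord_recr /= {2}/d eqxx -addrA; congr (_ + _).
    by apply: eq_bigr => i _; rewrite /d ltn_eqF.
  by rewrite mulrDl exprS mulrA.
Qed.

(** Divisibility gives [t = a + t^2 b], and [b] is a polynomial in [t]. The
    resulting relation has coefficient [-1] in degree [1]. *)
Lemma inv_in_sub t : B t -> ~ A t -> A t^-1.
Proof.
move=> Bt nAt; have t_neq0 : t != 0.
  by apply: contra_notN nAt => /eqP ->; apply: subring0.
have [a [b [Aa Bb et]]] :=
  conductor0_divisible minAB cond0 (subringX subB 2 Bt) (expf_neq0 2 t_neq0) Bt.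
have [n [d Ad eb]] := minimal_adjoin subA minAB Bt nAt Bb.
(* the coefficients of [a - t + t^2 b], where [b = d_0 + d_1 t + ...] *)
pose c i := if i is i'.+1 then if i' is i''.+1 then d i'' else -1 else a.
apply: (@unit_coef_inv c n.+1 1) => //.
- case=> [|[|i]] //=; apply: subringN => //; exact: subring1.
- move=> /= MN1; apply: M1; rewrite -[1]opprK -mulN1r.
  by apply: (idealM idM) => //; apply: (ideal_sub idM).
- rewrite big_ord_recl big_ord_recl /= expr0 expr1 mulr1 mulN1r addrA.
  rewrite [X in _ - X]et eb mulr_sumr opprD addrA subrr add0r.
  apply/eqP; rewrite addrC subr_eq0; apply/eqP; apply: eq_bigr => i _.
  by rewrite /bump /= !exprS; ring.
Qed.

(** For nonzero [x] in [M] and [u] outside [A], write [u = a + x b]. Then [x b]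
    is outside [A], hence invertible in [B], and so is its factor [x]. *)
Lemma ideal_inv x : M x -> x != 0 -> B x^-1.
Proof.
move=> Mx x_neq0; have Ax := ideal_sub idM Mx.
have [u Bu nAu] := minimal_ex minAB.
have [a [b [Aa Bb eu]]] :=
  conductor0_divisible minAB cond0 (AB Ax) x_neq0 Bu.
have nAxb : ~ A (x * b).
  by move=> Axb; apply: nAu; rewrite eu; apply: subringD.
have xb_neq0 : x * b != 0.
  by apply: contra_notN nAxb => /eqP ->; apply: subring0.
have -> : x^-1 = b * (x * b)^-1.
  by move: xb_neq0; rewrite mulf_eq0 negb_or => /andP[x0 b0]; field; apply/andP.
apply: subringM => //; apply/AB/inv_in_sub => //.
by apply: subringM => //; apply: AB.
Qed.

Lemma minimal_quotient_field : B = quotient_field A.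
Proof.
apply/seteqP; split=> x.
  move=> Bx; case: (pselect (A x)) => [Ax|nAx].
    exists x, 1; split=> //; [exact: subring1|exact: oner_neq0|].
    by rewrite divr1.
  exists 1, x^-1; split; [exact: subring1|exact: inv_in_sub| |].
    by rewrite invr_eq0; apply: contra_notN nAx => /eqP ->; apply: subring0.
  by rewrite invrK mul1r.
move=> [a [b [Aa Ab b_neq0 ->]]]; apply: subringM => //; first exact: AB.
by case: (pselect (M b)) => [Mb|nMb]; [apply: ideal_inv|apply/AB/invA].
Qed.

Lemma minimal_valuation_ring : valuation_ring A.
Proof.
split=> // x; rewrite -minimal_quotient_field => Bx _.
by case: (pselect (A x)) => [|/(inv_in_sub Bx)]; [left|right].
Qed.

(** For nonzero [x] in [M] the ring of all [a / x^n] contains [1/x], which is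
    not in [A], hence it is [B]. *)
Lemma denominator_power x y : M x -> x != 0 -> B y -> exists n, A (x ^+ n * y).
Proof.
move=> Mx x_neq0 By; have Ax := ideal_sub idM Mx.
pose S := [set z | B z /\ exists n, A (x ^+ n * z)].
have subS : is_subring S.
  apply/is_subringP; split.
  - split; first exact: subring1.
    by exists 0%N; rewrite mulr1 expr0; apply: subring1.
  - move=> u v [Bu [i Au]] [Bv [j Av]]; split; first exact: subringB.
    exists (i + j)%N; have -> : x ^+ (i + j) * (u - v) =
      x ^+ j * (x ^+ i * u) - x ^+ i * (x ^+ j * v) by rewrite exprD; ring.
    by apply: subringB => //; apply: subringM => //; apply: subringX.
  - move=> u v [Bu [i Au]] [Bv [j Av]]; split; first exact: subringM.
    exists (i + j)%N; have -> : x ^+ (i + j) * (u * v) =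
      (x ^+ i * u) * (x ^+ j * v) by rewrite exprD; ring.
    exact: subringM.
suff /(_ y By) [] : B `<=` S by [].
apply: (@minimal_intermediate_all _ _ _ minAB _ x^-1) => //.
- by move=> a Aa; split; [apply: AB|exists 0%N; rewrite expr0 mul1r].
- by move=> z [].
- split; first exact: ideal_inv.
  by exists 1%N; rewrite expr1 divff //; apply: subring1.
- move=> Axi; apply: M1; rewrite -(mulVf x_neq0); exact: (idealM idM).
Qed.

Lemma prime_ideal_proper P : prime_ideal A P -> P `<=` M.
Proof.
move=> [idP nPA _] x Px; apply: contrapT => nMx; apply: nPA.
apply: (ideal_eq_ring idP).
have x_neq0 : x != 0 by apply: contra_notN nMx => /eqP ->; apply: (ideal0 idM).
rewrite -(mulVf x_neq0); apply: (idealM idP) => //; apply: invA => //.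
exact: (ideal_sub idP).
Qed.

Lemma prime_ideal_max P p : prime_ideal A P -> P p -> p != 0 -> P = M.
Proof.
move=> primeP Pp p_neq0; apply/seteqP; split; first exact: prime_ideal_proper.
have [idP nPA mulP] := primeP.
move=> x Mx; have [->|x_neq0] := eqVneq x 0; first exact: (ideal0 idP).
have Ax := ideal_sub idM Mx.
have Bpi : B p^-1 by apply: ideal_inv => //; apply: prime_ideal_proper Pp.
have [n An] := denominator_power Mx x_neq0 Bpi.
have : P (x ^+ n) by rewrite -(mulfVK p_neq0 (x ^+ n)); apply: (idealM idP).
elim: n {An} => [|n IHn]; first by rewrite expr0 => /(ideal_eq_ring idP).
by rewrite exprS => /mulP[||//|//] //; apply: subringX.
Qed.

Lemma minimal_altitude1 : has_altitude A 1.
Proof.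
split.
  exists (fun i => if i is 0%N then [set 0] else M); split=> [i _|].
    case: i => [|i]; split.
    - split=> [_ ->|//|_ _ -> ->|a _ _ ->] //=.
      + exact: subring0.
      + by rewrite addr0.
      + by rewrite mulr0.
    - by move=> eA; have := Am; rewrite -eA /=; apply/eqP.
    - move=> x y _ _ /= /eqP; rewrite mulf_eq0.
      by case/orP => /eqP; [left|right].
    - exact: idM.
    - by move=> eMA; apply: M1; rewrite eMA; apply: subring1.
    - move=> x y Ax Ay Mxy; case: (pselect (M x)) => [|nMx]; first by left.
      have x_neq0 : x != 0.
        by apply: contra_notN nMx => /eqP ->; apply: (ideal0 idM).
      right; rewrite -(mulKf x_neq0 y); apply: (idealM idM) => //.
      exact: invA.
  case=> // _; split=> [_ ->|sM0]; first exact: (ideal0 idM).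
  by have /eqP := sM0 _ Mm; apply/negP.
case=> [|[|n]] // Q [primeQ ltQ].
have [_ nQ10] := ltQ 0%N isT; have [Q12 nQ21] := ltQ 1%N isT.
have [p Q1p np] : exists2 p, Q 1%N p & ~ Q 0%N p.
  by apply: contra_notP nQ10 => h x Qx; apply: contrapT => nQ; apply: h; exists x.
have p_neq0 : p != 0.
  apply: contra_notN np => /eqP ->; have [idQ _ _] := primeQ 0%N isT.
  exact: (ideal0 idQ).
case: nQ21; rewrite (prime_ideal_max (primeQ 1%N isT) Q1p p_neq0).
exact: prime_ideal_proper (primeQ 2%N isT).
Qed.

End Local.

(** * Localization at a maximal ideal *)

Section LocalizationAtMax.
Variable T : idomainType.
Variables (R J : set T).
Hypotheses (subR : is_subring R) (maxJ : maximal_ideal R J).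
Local Notation "x %:F" := (@FracField.tofrac T x).
Local Notation loc := (localization R J).

Let idJ : is_ideal R J. Proof. by case: maxJ. Qed.

Lemma maximal_ideal_not1 : ~ J 1.
Proof. by case: maxJ => _ nJR _ J1; apply: nJR; apply: ideal_eq_ring idJ J1. Qed.

Lemma denominator_neq0 s : ~ J s -> s%:F != 0.
Proof.
by rewrite tofrac_eq0 => nJs; apply: contra_notN nJs => /eqP ->; apply: (ideal0 idJ).
Qed.

Lemma localization_frac (A : set T) a s :
  A a -> R s -> ~ J s -> loc A (a%:F / s%:F).
Proof. by move=> Aa Rs nJs; exists a, s. Qed.

Lemma sub_localization (A : set T) a : A a -> loc A a%:F.
Proof.
move=> Aa; rewrite -[a%:F]divr1 -tofrac1.
by apply: localization_frac; [|exact: subring1|exact: maximal_ideal_not1].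
Qed.

Lemma localization_mono (A B : set T) : A `<=` B -> loc A `<=` loc B.
Proof. by move=> AB _ [a [s [Aa Rs nJs ->]]]; exists a, s; split=> //; apply: AB. Qed.

Lemma localizationM (A B C : set T) x y :
  (forall a b, A a -> B b -> C (a * b)) -> loc A x -> loc B y -> loc C (x * y).
Proof.
move=> ABC [a [s [Aa Rs nJs ->]]] [b [r [Bb Rr nJr ->]]].
rewrite mulrACA -invfM -!tofracM; apply: localization_frac; first exact: ABC.
  exact: subringM.
exact: (maximal_ideal_mul subR maxJ).
Qed.

Lemma localizationD (A : set T) x y :
  (forall r a, R r -> A a -> A (r * a)) ->
  (forall a b, A a -> A b -> A (a + b)) -> loc A x -> loc A y -> loc A (x + y).
Proof.
move=> RA AD [a [s [Aa Rs nJs ->]]] [b [r [Ab Rr nJr ->]]].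
rewrite addf_div ?denominator_neq0 // -!tofracM -tofracD.
apply: localization_frac; last exact: (maximal_ideal_mul subR maxJ).
  by apply: AD; rewrite mulrC; apply: RA.
exact: subringM.
Qed.

Lemma localization_subring (A : set T) : is_subring A -> R `<=` A ->
  is_subring (loc A).
Proof.
move=> subA RA; have AM := @localizationM A A A _ _ (@subringM _ _ subA).
apply/is_subringP; split=> // [|x y Ax Ay].
  by rewrite -(tofrac1 T); apply: sub_localization; apply: subring1.
apply: localizationD => // [r a /RA|a b|].
- exact: subringM.
- exact: subringD.
rewrite -mulN1r; apply: AM => //; rewrite -tofrac1 -tofracN.
by apply: sub_localization; apply: subringN => //; apply: subring1.
Qed.

Lemma localization_ideal : is_ideal (loc R) (loc J).
Proof.
split.
- by apply: localization_mono => j; apply: (ideal_sub idJ).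
- by rewrite -tofrac0; apply: sub_localization; apply: (ideal0 idJ).
- move=> x y; apply: localizationD => a b; first exact: (idealM idJ).
  exact: (idealD idJ).
- by move=> a x; apply: localizationM => r j; apply: (idealM idJ).
Qed.

Lemma localization_not1 : ~ loc J 1.
Proof.
move=> [j [s [Jj Rs nJs e]]]; have s_neq0 := denominator_neq0 nJs.
apply: nJs; suff -> : s = j by [].
apply/eqP; rewrite -tofrac_eq; apply/eqP.
by rewrite -[LHS]mul1r e divfK.
Qed.

Lemma localization_unit x : loc R x -> ~ loc J x -> loc R x^-1.
Proof.
move=> [a [s [Ra Rs nJs ->]]] nJx; rewrite invf_div.
by apply: localization_frac => // Ja; apply: nJx; apply: localization_frac.
Qed.

Hypothesis minRT : minimal_ring_extension R [set: T].
Hypothesis crucial : loc R <> loc [set: T].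

(** The elements of [T] lying in the localization of [R] form a ring between [R]
    and [T], and that ring cannot be [T] at the crucial maximal ideal. *)
Lemma crucial_contract t : loc R t%:F -> R t.
Proof.
move=> Rt; apply: contrapT => nRt; apply: crucial.
have subRJ := localization_subring subR (@subset_refl _ R).
pose S := [set u | loc R u%:F].
have subS : is_subring S.
  apply/is_subringP; split; rewrite /S /=.
  - by rewrite tofrac1; apply: subring1.
  - by move=> x y; rewrite tofracB; apply: subringB.
  - by move=> x y; rewrite tofracM; apply: subringM.
have RS : R `<=` S by move=> u; apply: sub_localization.
have ST := minimal_intermediate_all minRT subS RS (@subsetT _ S) Rt nRt.
apply/seteqP; split; first exact: localization_mono.
move=> _ [a [s [_ Rs nJs ->]]]; apply: subringM => //; first exact: ST.
apply: localization_unit; first exact: sub_localization.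
move=> [j [r [Jj Rr nJr e]]].
apply: (maximal_ideal_mul subR maxJ Rs Rr nJs nJr); suff -> : s * r = j by [].
apply/eqP; rewrite -tofrac_eq tofracM e divfK //; exact: denominator_neq0.
Qed.

(** An intermediate ring [S] is determined by its contraction to [T]: it is
    recovered by inverting the elements of [R] outside [J]. *)
Lemma localization_minimal : minimal_ring_extension (loc R) (loc [set: T]).
Proof.
have [_ subT _ _] := minRT; have RT : R `<=` [set: T] by [].
have RTJ := localization_mono RT.
split; [exact: localization_subring|exact: localization_subring| |].
  by split=> // TR; apply: crucial; apply/seteqP.
move=> [S [subS [RS nSR] [ST nTS]]].
pose S' := [set u : T | S u%:F].
have subS' : is_subring S'.
  apply/is_subringP; split; rewrite /S' /=.
  - by rewrite tofrac1; apply: subring1.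
  - by move=> x y; rewrite tofracB; apply: subringB.
  - by move=> x y; rewrite tofracM; apply: subringM.
have RS' : R `<=` S' by move=> u Ru; apply: RS; apply: sub_localization.
have sR a : R a -> loc R a%:F by apply: sub_localization.
case: (minimal_intermediate minRT subS' RS' (@subsetT _ S')) => eS'.
  apply: nSR => x Sx; have [a [s [_ Rs nJs ex]]] := ST x Sx.
  rewrite ex; apply: localization_frac => //; rewrite -eS' /S' /=.
  have -> : a%:F = x * s%:F by rewrite ex divfK // denominator_neq0.
  by apply: subringM => //; apply: RS; apply: sR.
apply: nTS => _ [a [s [_ Rs nJs ->]]].
apply: subringM => //; first by suff: S' a by []; rewrite eS'.
apply: RS; rewrite -[s%:F^-1]mul1r -tofrac1.
by apply: localization_frac => //; apply: subring1.
Qed.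

(** If [a / s] is in the conductor of the localizations, then [aT] lies in
    the localization of [R], hence in [R] by contraction. *)
Lemma localization_conductor0 : conductor R [set: T] = [set 0] ->
  conductor (loc R) (loc [set: T]) = [set 0].
Proof.
move=> cond0; apply/seteqP; split=> [x [Tx condx]|_ -> /=]; last first.
  split=> [|u _]; first by rewrite -tofrac0; apply: sub_localization.
  rewrite mul0r -tofrac0; apply: sub_localization; exact: subring0.
have [a [s [_ Rs nJs ex]]] := Tx.
have : conductor R [set: T] a.
  split=> // u _; apply: crucial_contract.
  have -> : (a * u)%:F = s%:F * (x * u%:F).
    by rewrite tofracM ex mulrA mulrC [s%:F * _]mulrC divfK ?denominator_neq0 // mulrC.
  apply: subringM; first exact: localization_subring.
    exact: sub_localization.
  by apply: condx; apply: sub_localization.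
by rewrite cond0 /= => a0; rewrite ex a0 tofrac0 mul0r.
Qed.

Lemma maximal_ideal0_field : (forall x, J x -> x = 0) -> is_field R.
Proof.
move=> J0; split=> // x Rx x_neq0.
pose I := [set y | exists2 r, R r & y = x * r].
have idI : is_ideal R I.
  split.
  - by move=> _ [r Rr ->]; apply: subringM.
  - by exists 0; [apply: subring0|rewrite mulr0].
  - move=> _ _ [r Rr ->] [s Rs ->]; exists (r + s); last by rewrite mulrDr.
    exact: subringD.
  - move=> a _ Ra [r Rr ->]; exists (a * r); last by rewrite mulrCA.
    exact: subringM.
have Ix : I x by exists 1; [apply: subring1|rewrite mulr1].
have JI : J `<=` I by move=> j /J0 ->; apply: (ideal0 idI).
have [_ _ max] := maxJ; case: (max I idI JI) => [IJ|IR].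
  by move/eqP: x_neq0; case; apply: J0; rewrite -IJ.
have [y Ry e1] : I 1 by rewrite IR; apply: subring1.
by exists y.
Qed.

End LocalizationAtMax.

(** * The characterization *)

Lemma conductor_over_field (T : comNzRingType) (A B : set T) :
  minimal_ring_extension A B -> is_field B -> conductor A B = [set 0].
Proof.
move=> minAB [_ invB]; have [subA subB [_ nBA] _] := minAB.
apply/seteqP; split=> [t [Bt condt]|_ -> /=]; last first.
  by split=> [|u _]; rewrite ?mul0r; apply: subring0.
apply: contrapT => /eqP t_neq0; apply: nBA => b Bb.
have [s Bs ts1] := invB t Bt t_neq0.
by rewrite -[b]mul1r -ts1 -mulrA; apply: condt; apply: subringM.
Qed.

Lemma quotient_field_is_field (K : fieldType) (A : set K) :
  is_subring A -> is_subring (quotient_field A) -> is_field (quotient_field A).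
Proof.
move=> subA subQ; split=> // _ [a [b [Aa Ab b_neq0 ->]]] ab_neq0.
exists (b / a); last by rewrite -[b / a]invf_div divff.
exists b, a; split=> //; apply: contraNneq ab_neq0 => ->.
by rewrite mul0r.
Qed.

Theorem theorem3p4 (T : idomainType) (R J : set T)
    (hRT : minimal_ring_extension R [set: T])
    (hJ : crucial_maximal_ideal R [set: T] J) :
  conductor R [set: T] = [set 0] <->
  (is_field R /\ minimal_field_extension R [set: T]) \/
  [/\ valuation_ring (localization R J R),
      has_altitude (localization R J R) 1 &
      localization R J [set: T] = quotient_field (localization R J R)].
Proof.
have [maxJ crucial] := hJ; have [subR subT _ _] := hRT.
have minRJ := localization_minimal subR maxJ hRT crucial.
split=> [cond0|[[_ [_ fieldT _]]|[_ _ eTQ]]].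
- case: (pselect (forall x, J x -> x = 0)) => [J0|nJ0].
    have fieldR := maximal_ideal0_field subR maxJ J0.
    by left; split=> //; split=> //; apply: minimal_over_field cond0 fieldR.
  have [j Jj j_neq0] : exists2 j, J j & j != 0.
    by apply: contra_notP nJ0 => h x Jx; apply: contrapT => /eqP ?; apply: h; exists x.
  have condRJ := localization_conductor0 subR maxJ hRT crucial cond0.
  have idM := localization_ideal subR maxJ.
  have M1 := localization_not1 maxJ.
  have invR := @localization_unit _ R J.
  have Mj : localization R J J (FracField.tofrac j) by apply: sub_localization.
  have Fj_neq0 : FracField.tofrac j != 0 by rewrite tofrac_eq0.
  right; split.
  + exact: (minimal_valuation_ring minRJ condRJ idM M1 invR Mj Fj_neq0).
  + exact: (minimal_altitude1 minRJ condRJ idM M1 invR Mj Fj_neq0).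
  + exact: (minimal_quotient_field minRJ condRJ idM M1 invR Mj Fj_neq0).
- exact: conductor_over_field fieldT.
- have [subRJ subTJ _ _] := minRJ.
  have fieldTJ : is_field (localization R J [set: T]).
    by rewrite eTQ; apply: quotient_field_is_field => //; rewrite -eTQ.
  have condRJ := conductor_over_field minRJ fieldTJ.
  apply/seteqP; split=> [t [_ condt]|_ -> /=]; last first.
    by split=> // u _; rewrite mul0r; apply: subring0.
  suff : conductor (localization R J R) (localization R J [set: T])
           (FracField.tofrac t).
    by rewrite condRJ /= => /eqP; rewrite tofrac_eq0 => /eqP.
  split; first exact: sub_localization.
  move=> _ [u [s [_ Rs nJs ->]]]; rewrite mulrA -tofracM.
  by apply: localization_frac => //; apply: condt.
Qed.
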